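(* Let $(A,\cdot_A,\Delta)$ be an ASI bialgebra and let $((A\oplus A^*,\cdot_d,\mathcal{B}_s),(A,\cdot_A),(A^*,\cdot_{A^*}))$ be the corresponding double construction of Frobenius algebras. Let $(B,\circ_B,\omega)$ be a quadratic perm algebra. Put $C=A\otimes B$ and $C^*=A^*\otimes B^*$, with the diassociative operations $\dashv_C,\vdash_C$, $\dashv_{C^*},\vdash_{C^*}$, and let $\dashv'_d,\vdash'_d$ be the operations on $C\oplus C^*$, all as defined in the context. Then $((C\oplus C^*,\dashv'_d,\vdash'_d,\omega_d),(C,\dashv_C,\vdash_C),(C^*,\dashv_{C^*},\vdash_{C^*}))$ is a standard Manin triple of diassociative algebras. Consequently, $(C,\dashv_C,\vdash_C,\Delta_{\dashv_C},\Delta_{\vdash_C})$ is a diassociative bialgebra, where $\Delta_{\dashv_C},\Delta_{\vdash_C}$ are the linear duals of $\dashv_{C^*},\vdash_{C^*}$, respectively.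
   Context: All vector spaces are finite-dimensional over a field $\mathbf{k}$ of characteristic $0$; associative algebras need not be unital. $\sigma(u\otimes v)=v\otimes u$; $L_\diamond(x)y=x\diamond y$, $R_\diamond(y)x=x\diamond y$. The linear dual of an operation $*$ on $V^*$ is $\Delta:V\to V\otimes V$ with $\langle\Delta(x),a^*\otimes b^*\rangle=\langle x,a^* * b^*\rangle$. ASI (antisymmetric infinitesimal) bialgebra $(A,\cdot_A,\Delta)$: $(A,\cdot_A)$ is an associative algebra, $(A,\Delta)$ a coassociative coalgebra, and for all $x,y\in A$: $\Delta(x\cdot_A y)=(R_{\cdot_A}(y)\otimes\mathrm{id})\Delta(x)+(\mathrm{id}\otimes L_{\cdot_A}(x))\Delta(y)$ and $(L_{\cdot_A}(x)\otimes\mathrm{id}-\mathrm{id}\otimes R_{\cdot_A}(x))\Delta(y)=\sigma((\mathrm{id}\otimes R_{\cdot_A}(y)-L_{\cdot_A}(y)\otimes\mathrm{id})\Delta(x))$. Double construction of Frobenius algebras $((A\oplus A^*,\cdot_d,\mathcal{B}_s),(A,\cdot_A),(A^*,\cdot_{A^*}))$: $(A\oplus A^*,\cdot_d)$ is an associative algebra containing $(A,\cdot_A)$ and $(A^*,\cdot_{A^*})$ as subalgebras, and the form $\mathcal{B}_s(x+a^*,y+b^* )=\langle x,b^*\rangle+\langle a^*,y\rangle$ is invariant ($\mathcal{B}_s(X\cdot_d Y,Z)=\mathcal{B}_s(X,Y\cdot_d Z)$). It is a known fact (Bai) that, when $\Delta$ is the linear dual of $\cdot_{A^*}$, $(A,\cdot_A,\Delta)$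 is an ASI bialgebra if and only if there is such a double construction; $\cdot_d$ is then uniquely determined by $\cdot_A$, $\cdot_{A^*}$ and the invariance of $\mathcal{B}_s$, and this is the corresponding double construction. Perm algebra $(B,\circ_B)$: $(x\circ_B y)\circ_B z=x\circ_B(y\circ_B z)=x\circ_B(z\circ_B y)$. It is quadratic with $\omega$ if $\omega$ is a nondegenerate antisymmetric bilinear form with $\omega(x\circ_B y,z)=\omega(y,z\circ_B x-x\circ_B z)$ for all $x,y,z$. Tensor operations: for an associative algebra $(E,\cdot)$ and a perm algebra $(P,\circ)$, $E\otimes P$ is a diassociative algebra with $(x\otimes a)\dashv(y\otimes b)=(x\cdot y)\otimes(a\circ b)$ and $(x\otimes a)\vdash(y\otimes b)=(x\cdot y)\otimes(b\circ a)$. Let $\dashv_C,\vdash_C$ be these operations on $C=A\otimes B$, and $\dashv_d,\vdash_d$ these operations on $(A\oplus A^* )\otimes B$ from $(A\oplus A^*,\cdot_d)$ and $(B,\circ_B)$. Let $\varphi:B\to B^*$, $\langle\varphi(a),b\rangle=\omega(a,b)$; give $B^*$ the perm operation $a^*\circ_{B^*}b^*=\varphi(\varphi^{-1}(a^* )\circ_B\varphi^{-1}(b^* ))$ and let $\dashv_{C^*},\vdash_{C^*}$ be the tensor operations on $C^*=A^*\otimes B^*$ (identified with the dual of $C$) from $(A^*,\cdot_{A^*})$ and $(B^*,\circ_{B^*})$. Let $f:(A\oplus A^* )\otimes B\to C\oplus C^*$ be the linear isomorphism $f(x\otimes a+y^*\otimes b)=x\otimes a+y^*\otimes\varphi(b)$,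 and define $X\dashv'_d Y:=f(f^{-1}(X)\dashv_d f^{-1}(Y))$, $X\vdash'_d Y:=f(f^{-1}(X)\vdash_d f^{-1}(Y))$ on $C\oplus C^*$. Diassociative algebra $(C,\dashv,\vdash)$: $(x\dashv y)\dashv z=x\dashv(y\dashv z)=x\dashv(y\vdash z)$; $(x\vdash y)\dashv z=x\vdash(y\dashv z)$; $(x\vdash y)\vdash z=(x\dashv y)\vdash z=x\vdash(y\vdash z)$. Put $\bullet:=\vdash-\dashv$. It is quadratic with $\varpi$ if $\varpi$ is nondegenerate antisymmetric bilinear with $\varpi(x,y\dashv z)=\varpi(z,x\bullet y)$, $\varpi(x\vdash y,z)=\varpi(x,y\bullet z)$. A standard Manin triple $((C\oplus C^*,\dashv,\vdash,\omega_d),(C,\dashv_C,\vdash_C),(C^*,\dashv_{C^*},\vdash_{C^*}))$ means: $(C\oplus C^*,\dashv,\vdash,\omega_d)$ is a quadratic diassociative algebra with $\omega_d(x+a^*,y+b^* )=\langle a^*,y\rangle-\langle x,b^*\rangle$, and $C,C^*$ are subalgebras with the given operations. Diassociative coalgebra $(C,\Delta_{\dashv},\Delta_{\vdash})$: $(\mathrm{id}\otimes\Delta_{\dashv})\Delta_{\dashv}=(\mathrm{id}\otimes\Delta_{\vdash})\Delta_{\dashv}=(\Delta_{\dashv}\otimes\mathrm{id})\Delta_{\dashv}$; $(\Delta_{\vdash}\otimes\mathrm{id})\Delta_{\dashv}=(\mathrm{id}\otimes\Delta_{\dashv})\Delta_{\vdash}$; $(\Delta_{\dashv}\otimes\mathrm{id})\Delta_{\vdash}=(\Delta_{\vdash}\otimes\mathrm{id})\Delta_{\vdash}=(\mathrm{id}\otimes\Delta_{\vdash})\Delta_{\vdash}$.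 Diassociative bialgebra $(C,\dashv,\vdash,\Delta_{\dashv},\Delta_{\vdash})$: a diassociative algebra and diassociative coalgebra such that, with $\Delta_{\bullet}:=\Delta_{\vdash}-\Delta_{\dashv}$, for all $x,y\in C$: (1) $\Delta_{\vdash}(x\dashv y)=(\mathrm{id}\otimes L_{\dashv}(x))\Delta_{\vdash}(y)-(R_{\bullet}(y)\otimes\mathrm{id})\Delta_{\vdash}(x)=(\mathrm{id}\otimes L_{\dashv}(x))\Delta_{\bullet}(y)+(R_{\dashv}(y)\otimes\mathrm{id})\Delta_{\vdash}(x)$; (2) $\sigma((L_{\vdash}(y)\otimes\mathrm{id})\Delta_{\vdash}(x))-(L_{\dashv}(x)\otimes\mathrm{id})\Delta_{\bullet}(y)=(L_{\dashv}(x)\otimes\mathrm{id})\Delta_{\dashv}(y)+\sigma((L_{\bullet}(y)\otimes\mathrm{id})\Delta_{\vdash}(x))=\sigma((\mathrm{id}\otimes R_{\dashv}(y))\Delta_{\vdash}(x))+(\mathrm{id}\otimes R_{\bullet}(x))\Delta_{\bullet}(y)$; (3) $\sigma((\mathrm{id}\otimes R_{\vdash}(y))\Delta_{\vdash}(x))-(\mathrm{id}\otimes R_{\bullet}(x))\Delta_{\dashv}(y)=(\mathrm{id}\otimes R_{\dashv}(x))\Delta_{\dashv}(y)+\sigma((\mathrm{id}\otimes R_{\vdash}(y))\Delta_{\bullet}(x))=(L_{\vdash}(x)\otimes\mathrm{id})\Delta_{\dashv}(y)+\sigma((L_{\bullet}(y)\otimes\mathrm{id})\Delta_{\bullet}(x))$;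 (4) $\Delta_{\dashv}(x\vdash y)=(\mathrm{id}\otimes L_{\vdash}(x))\Delta_{\dashv}(y)-(R_{\vdash}(y)\otimes\mathrm{id})\Delta_{\bullet}(x)=(\mathrm{id}\otimes L_{\bullet}(x))\Delta_{\dashv}(y)+(R_{\vdash}(y)\otimes\mathrm{id})\Delta_{\dashv}(x)$; (5) $\Delta_{\dashv}(x\dashv y)=(R_{\dashv}(y)\otimes\mathrm{id})\Delta_{\dashv}(x)-(\mathrm{id}\otimes L_{\bullet}(x))\Delta_{\bullet}(y)$; (6) $\Delta_{\vdash}(x\vdash y)=(\mathrm{id}\otimes L_{\vdash}(x))\Delta_{\vdash}(y)-(R_{\bullet}(y)\otimes\mathrm{id})\Delta_{\bullet}(x)$. *)

(* Defs.v *)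
From HB Require Import structures.
From mathcomp Require Import all_boot all_order all_algebra.
Set Implicit Arguments.
Unset Strict Implicit.
Unset Printing Implicit Defensive.
Import GRing.Theory.
Local Open Scope ring_scope.

Notation bilinear_op f := (bilinear_for *:%R *:%R f).
Notation bilinear_form f := (bilinear_for *%R *%R f).

Definition dual (k : fieldType) (V : vectType k) : vectType k := 'Hom(V, k^o).
Definition dsum (k : fieldType) (V : vectType k) : vectType k :=
  (V * dual V)%type.

(* A tensor is stored as the matrix of its coordinates in the products of the
   basis vectors of the two factors; tens_bilinear, tlift_linear, tlift_tens and
   tens_ext below are the universal property. *)
Definition tensor (k : fieldType) (U V : vectType k) : vectType k :=
  'M[k]_(\dim {:U}, \dim {:V}).

Section Tensor.
Variable k : fieldType.
Implicit Types U V W X : vectType k.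

Definition tens U V (u : U) (v : V) : tensor U V :=
  \matrix_(i, j) (coord (vbasis {:U}) i u * coord (vbasis {:V}) j v).

(* The linear map U (x) V -> W induced by a bilinear map b : U x V -> W. *)
Definition tlift U V W (b : U -> V -> W) (t : tensor U V) : W :=
  \sum_i \sum_j (t : 'M_(_, _)) i j *: b (vbasis {:U})`_i (vbasis {:V})`_j.

Lemma tens_bilinear U V : bilinear_op (@tens U V).
Proof.
split=> [v|u] c x y; apply/matrixP=> i j; rewrite !mxE linearP /=.
  by rewrite mulrDl mulrA.
by rewrite mulrDr !mulrA (mulrC c).
Qed.

Lemma tlift_linear U V W (b : U -> V -> W) : linear (tlift b).
Proof.
move=> c s t; rewrite /tlift scaler_sumr -big_split /=; apply: eq_bigr => i _.
rewrite scaler_sumr -big_split /=; apply: eq_bigr => j _.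
by rewrite !mxE scalerDl scalerA.
Qed.

Lemma lin_sum U W (g : U -> W) I (r : seq I) (P : pred I) (c : I -> k)
    (x : I -> U) : linear g ->
  g (\sum_(i <- r | P i) c i *: x i) = \sum_(i <- r | P i) c i *: g (x i).
Proof.
move=> lg; have g0 : g 0 = 0.
  by have := lg (-1) 0 0; rewrite scaler0 addr0 scaleN1r addNr.
elim/big_rec2: _ => [|i y1 y2 _ <-]; first exact: g0.
by rewrite lg.
Qed.

Lemma tens0l U V (v : V) : tens (0 : U) v = 0.
Proof. by apply/matrixP => i j; rewrite !mxE linear0 mul0r. Qed.

Lemma lin_sum2 U W (g : U -> W) (I J : finType) (c : I -> J -> k)
    (x : I -> J -> U) : linear g ->
  g (\sum_i \sum_j c i j *: x i j) = \sum_i \sum_j c i j *: g (x i j).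
Proof. by move=> lg; rewrite !pair_bigA lin_sum. Qed.

Lemma tlift_tens U V W (b : U -> V -> W) u v :
  bilinear_op b -> tlift b (tens u v) = b u v.
Proof.
move=> [bl br].
rewrite {2}(coord_vbasis (memvf u)) {2}(coord_vbasis (memvf v)).
rewrite (lin_sum _ _ _ _ (bl _)); apply: eq_bigr => i _.
rewrite (lin_sum _ _ _ _ (br _)) scaler_sumr; apply: eq_bigr => j _.
by rewrite mxE scalerA.
Qed.

Lemma tens_sum U V (t : tensor U V) :
  t = \sum_i \sum_j (t : 'M_(_, _)) i j *:
        tens (vbasis {:U})`_i (vbasis {:V})`_j.
Proof.
rewrite [LHS]matrix_sum_delta; apply: eq_bigr => i _; apply: eq_bigr => j _.
apply/matrixP=> i' j'; rewrite !mxE.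
rewrite !coord_free ?(basis_free (vbasisP _)) //.
by rewrite -natrM mulnb (eq_sym i) (eq_sym j).
Qed.

Lemma tens_ext U V W (g h : tensor U V -> W) : linear g -> linear h ->
  (forall u v, g (tens u v) = h (tens u v)) -> g =1 h.
Proof.
move=> lg lh gh t; rewrite (tens_sum t) (lin_sum2 _ _ lg) (lin_sum2 _ _ lh).
by apply: eq_bigr => i _; apply: eq_bigr => j _; rewrite gh.
Qed.

Definition tmap U V U' V' (g : U -> U') (h : V -> V') :
    tensor U V -> tensor U' V' :=
  tlift (fun u v => tens (g u) (h v)).

Definition tswap U V : tensor U V -> tensor V U :=
  tlift (fun u v => tens v u).

Definition tassoc U V W :
    tensor (tensor U V) W -> tensor U (tensor V W) :=
  tlift (fun t w => tlift (fun u v => tens u (tens v w)) t).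

Definition tpair U V (T : tensor (dual U) (dual V)) (t : tensor U V) : k^o :=
  tlift (fun (a : dual U) (b : dual V) =>
    tlift (fun u v => (a u * b v : k^o)) t) T.

(* The identification of U^* (x) V^* with (U (x) V)^*. *)
Definition tdual U V : 'Hom(tensor (dual U) (dual V), dual (tensor U V)) :=
  linfun (fun T => linfun (tpair T) : dual (tensor U V)).

Definition is_linear_dual V (Delta : V -> tensor V V)
    (m : dual V -> dual V -> dual V) : Prop :=
  forall (x : V) (a b : dual V), tpair (tens a b) (Delta x) = m a b x.

Definition tensor_op U V (m : U -> U -> U) (n : V -> V -> V)
    (s t : tensor U V) : tensor U V :=
  tlift (fun x a => tlift (fun y b => tens (m x y) (n a b)) t) s.

Lemma tlift_eq U V W (b b' : U -> V -> W) t :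
  b =2 b' -> tlift b t = tlift b' t.
Proof. by move=> e; do 2!(apply: eq_bigr => ? _); rewrite e. Qed.

Lemma tlift_comb U V W c (b b' : U -> V -> W) t :
  tlift (fun u v => c *: b u v + b' u v) t = c *: tlift b t + tlift b' t.
Proof.
rewrite /tlift scaler_sumr -big_split; apply: eq_bigr => i _ /=.
rewrite scaler_sumr -big_split; apply: eq_bigr => j _ /=.
by rewrite scalerDr !scalerA mulrC.
Qed.

Lemma linfun_lin U V (g : U -> V) (lg : linear g) x : linfun g x = g x.
Proof.
pose M := GRing.isLinear.Build k U V *:%R g lg.
pose gl : {linear U -> V} := HB.pack g M.
exact: (lfunE gl).
Qed.

Lemma linfun_linear U V W (b : U -> V -> W) : bilinear_op b ->
  linear (fun u => linfun (b u)).
Proof.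
move=> [bl br] c x y; apply/lfunP => v.
by rewrite add_lfunE scale_lfunE !linfun_lin // bl.
Qed.

Lemma tpair_linearr U V (T : tensor (dual U) (dual V)) : linear (tpair T).
Proof.
move=> c s t; rewrite /tpair -tlift_comb; apply: tlift_eq => a b.
exact: tlift_linear.
Qed.

Lemma tpair_tens U V (a : dual U) (b : dual V) u v :
  tpair (tens a b) (tens u v) = a u * b v.
Proof.
have sb (a' : dual U) (b' : dual V) :
    bilinear_op (fun u v => (a' u * b' v : k^o)).
  split=> [v'|u'] c x y; rewrite linearP /=.
    by rewrite mulrDl /GRing.scale /= mulrA.
  by rewrite mulrDr /GRing.scale /= mulrCA.
rewrite /tpair tlift_tens; first by rewrite tlift_tens.
split=> [b'|a'] c x y /=; rewrite -tlift_comb; apply: tlift_eq => u' v'.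
  by rewrite add_lfunE scale_lfunE mulrDl /GRing.scale /= mulrA.
by rewrite add_lfunE scale_lfunE mulrDr /GRing.scale /= mulrCA.
Qed.

Lemma tdualE U V T (t : tensor U V) : tdual U V T t = tpair T t.
Proof.
rewrite /tdual linfun_lin; last apply: linfun_linear; last split=> [t'|T'].
- by rewrite linfun_lin //; exact: tpair_linearr.
- exact: tlift_linear.
- exact: tpair_linearr.
Qed.

Lemma tdual_tens U V (a : dual U) (b : dual V) u v :
  tdual U V (tens a b) (tens u v) = a u * b v.
Proof. by rewrite tdualE tpair_tens. Qed.

Lemma lfun_surj_bij U V (g : 'Hom(U, V)) : \dim {:U} = \dim {:V} ->
  (forall v, exists u, g u = v) -> cancel g g^-1%VF /\ cancel g^-1%VF g.
Proof.
move=> dUV gs; have gT : limg g = fullv.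
  apply/eqP; rewrite eqEsubv subvf /=; apply/subvP => v _.
  by have [u <-] := gs v; rewrite memv_img ?memvf.
have g0 : lker g = 0%VS.
  apply/eqP; rewrite -dimv_eq0 -(capfv (lker g)) -(eqn_add2r (\dim (limg g))).
  by rewrite limg_ker_dim gT add0n dUV.
split; first by apply: lker0_lfunK; rewrite g0.
by move=> v; rewrite limg_lfunVK // gT memvf.
Qed.

Lemma dim_dual V : \dim {:dual V} = \dim {:V}.
Proof. by rewrite !dimvf /dim /= muln1. Qed.

Lemma dim_tensor U V : \dim {:tensor U V} = (\dim {:U} * \dim {:V})%N.
Proof. by rewrite dimvf /dim. Qed.

Definition dual_basis V (i : 'I_(\dim {:V})) : dual V :=
  linfun (coord (vbasis {:V}) i : V -> k^o).

Definition linear_dual V (m : dual V -> dual V -> dual V) (x : V) :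
    tensor V V :=
  \matrix_(i, j) m (dual_basis i) (dual_basis j) x.

Lemma dual_sum V (a : dual V) :
  a = \sum_(i < \dim {:V}) a (vbasis {:V})`_i *: dual_basis i.
Proof.
apply/lfunP => x; rewrite {1}(coord_vbasis (memvf x)) linear_sum sum_lfunE.
apply: eq_bigr => i _; rewrite linearZ scale_lfunE lfunE /GRing.scale /=.
exact: mulrC.
Qed.

Lemma tdual_surj U V (z : dual (tensor U V)) : exists T, tdual U V T = z.
Proof.
exists (\sum_(i < \dim {:U}) \sum_(j < \dim {:V}) z (tens (vbasis {:U})`_i (vbasis {:V})`_j) *:
  tens (dual_basis i) (dual_basis j)).
apply/lfunP; apply: tens_ext => [c x y|c x y|u v]; rewrite ?linearP //.
rewrite linear_sum sum_lfunE /=.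
have [tl tr] := tens_bilinear U V.
rewrite {2}(coord_vbasis (memvf u)) {2}(coord_vbasis (memvf v)).
rewrite (lin_sum _ _ _ _ (tl _)) linear_sum; apply: eq_bigr => i _.
rewrite linear_sum sum_lfunE linearZ (lin_sum _ _ _ _ (tr _)) linear_sum.
rewrite [RHS]mulr_sumr; apply: eq_bigr => j _.
rewrite !linearZ /= scale_lfunE tdual_tens !lfunE /= /GRing.scale /=.
by rewrite mulrC -mulrA; congr (_ * _); rewrite mulrC.
Qed.

Lemma tdual_bij U V :
  cancel (tdual U V) (tdual U V)^-1%VF /\ cancel (tdual U V)^-1%VF (tdual U V).
Proof.
apply: lfun_surj_bij; last exact: tdual_surj.
by rewrite dim_dual !dim_tensor !dim_dual.
Qed.

Lemma linear_dualP V (m : dual V -> dual V -> dual V) : bilinear_op m ->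
  linear (linear_dual m) /\ is_linear_dual (linear_dual m) m.
Proof.
move=> [ml mr]; split=> [c x y|x a b].
  by apply/matrixP => i j; rewrite !mxE linearP.
rewrite (tens_sum (linear_dual m x)) {2}(dual_sum a) {2}(dual_sum b).
rewrite (lin_sum2 _ _ (tpair_linearr _)).
rewrite (lin_sum _ _ _ _ (ml _)) sum_lfunE; apply: eq_bigr => i _.
rewrite scale_lfunE (lin_sum _ _ _ _ (mr _)) sum_lfunE [RHS]mulr_sumr.
apply: eq_bigr => j _; rewrite scale_lfunE tpair_tens mxE /GRing.scale /=.
by rewrite mulrC mulrA.
Qed.

Lemma linear_dual_uniq V (m : dual V -> dual V -> dual V)
    (D D' : V -> tensor V V) :
  is_linear_dual D m -> is_linear_dual D' m -> D =1 D'.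
Proof.
move=> hD hD' x; have E t i j : (t : 'M_(_, _)) i j =
    tpair (tens (dual_basis i) (dual_basis j)) (t : tensor V V).
  rewrite {2}(tens_sum t) pair_bigA (lin_sum _ _ _ _ (tpair_linearr _)) /=.
  rewrite (bigD1 (i, j)) //= big1 => [|[i' j'] /= ne].
    rewrite addr0 tpair_tens !lfunE /= !coord_free ?(basis_free (vbasisP _)) //.
    by rewrite !eqxx mulr1 [RHS]mulr1.
  rewrite tpair_tens !lfunE /= !coord_free ?(basis_free (vbasisP _)) //.
  rewrite -natrM mulnb.
  by move: ne; rewrite xpair_eqE => /negPf ->; rewrite [LHS]mulr0.
by apply/matrixP => i j; rewrite !E hD hD'.
Qed.

Lemma tlift_bilinear U V W X (b : X -> U -> V -> W) :
  (forall u v, linear (fun x => b x u v)) ->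
  bilinear_op (fun x t => tlift (b x) t).
Proof.
move=> lb; split=> [t|x] c y z; last exact: tlift_linear.
by rewrite -tlift_comb; apply: tlift_eq => u v; rewrite lb.
Qed.

Lemma tensor_op_tens U V (m : U -> U -> U) (n : V -> V -> V) x a y b :
  bilinear_op m -> bilinear_op n ->
  tensor_op m n (tens x a) (tens y b) = tens (m x y) (n a b).
Proof.
move=> [ml mr] [nl nr]; have [tl tr] := tens_bilinear U V.
have inner x' a' : bilinear_op (fun y b => tens (m x' y) (n a' b)).
  by split=> [b'|y'] c u v; rewrite /= ?mr ?nr ?tl ?tr.
rewrite /tensor_op tlift_tens; first by rewrite tlift_tens.
split=> [a'|x'] c u v /=; rewrite -tlift_comb; apply: tlift_eq => y' b' /=.
  by rewrite ml tl.
by rewrite nl tr.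
Qed.

End Tensor.

Arguments tswap {k U V}.
Arguments tassoc {k U V W}.
Arguments tdual {k U V}.

Section Structures.
Variable k : fieldType.
Implicit Types U V W A B C : vectType k.

Definition associative_algebra V (m : V -> V -> V) : Prop :=
  bilinear_op m /\ associative m.

Definition coassociative_coalgebra V (Delta : V -> tensor V V) : Prop :=
  linear Delta /\
  forall x, tassoc (tmap Delta id (Delta x)) = tmap id Delta (Delta x).

Definition ASI_bialgebra A (m : A -> A -> A) (Delta : A -> tensor A A) : Prop :=
  [/\ associative_algebra m,
      coassociative_coalgebra Delta,
      forall x y, Delta (m x y) =
        tmap (m^~ y) id (Delta x) + tmap id (m x) (Delta y)
    & forall x y,
        tmap (m x) id (Delta y) - tmap id (m^~ x) (Delta y) =
        tswap (tmap id (m^~ y) (Delta x) - tmap (m y) id (Delta x))].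

(* B_s on V + V^* *)
Definition form_s V (X Y : dsum V) : k := Y.2 X.1 + X.2 Y.1.

(* omega_d on V + V^* *)
Definition form_d V (X Y : dsum V) : k := X.2 Y.1 - Y.2 X.1.

(* (V, m) and (V^*, ms) are subalgebras of (V + V^*, md). *)
Definition extends_ops V (md : dsum V -> dsum V -> dsum V)
    (m : V -> V -> V) (ms : dual V -> dual V -> dual V) : Prop :=
  (forall x y : V, md (x, 0) (y, 0) = (m x y, 0)) /\
  (forall a b : dual V, md (0, a) (0, b) = (0, ms a b)).

Definition double_construction V (md : dsum V -> dsum V -> dsum V)
    (m : V -> V -> V) (ms : dual V -> dual V -> dual V) : Prop :=
  [/\ associative_algebra md,
      extends_ops md m ms
    & forall X Y Z, form_s (md X Y) Z = form_s X (md Y Z)].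

Definition perm_algebra V (p : V -> V -> V) : Prop :=
  bilinear_op p /\
  (forall x y z, p (p x y) z = p x (p y z) /\ p x (p y z) = p x (p z y)).

Definition symplectic_form V (w : V -> V -> k) : Prop :=
  [/\ bilinear_form w,
      forall x y, w x y = - w y x
    & forall x, (forall y, w x y = 0) -> x = 0].

Definition quadratic_perm V (p : V -> V -> V) (w : V -> V -> k) : Prop :=
  [/\ perm_algebra p,
      symplectic_form w
    & forall x y z, w (p x y) z = w y (p z x - p x z)].

(* In a pair (l, r) of diassociative operations, l is -| and r is |-. *)
Definition op_bullet V (l r : V -> V -> V) (x y : V) : V := r x y - l x y.

Definition diassociative_algebra V (l r : V -> V -> V) : Prop :=
  [/\ bilinear_op l /\ bilinear_op r,
      forall x y z, l (l x y) z = l x (l y z) /\ l x (l y z) = l x (r y z),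
      forall x y z, l (r x y) z = r x (l y z)
    & forall x y z, r (r x y) z = r (l x y) z /\ r (l x y) z = r x (r y z)].

Definition quadratic_diassociative V (l r : V -> V -> V)
    (w : V -> V -> k) : Prop :=
  [/\ diassociative_algebra l r,
      symplectic_form w,
      forall x y z, w x (l y z) = w z (op_bullet l r x y)
    & forall x y z, w (r x y) z = w x (op_bullet l r y z)].

Definition standard_Manin_triple C (l r : dsum C -> dsum C -> dsum C)
    (lC rC : C -> C -> C) (lCs rCs : dual C -> dual C -> dual C) : Prop :=
  [/\ quadratic_diassociative l r (@form_d C),
      extends_ops l lC lCs
    & extends_ops r rC rCs].

Definition diassociative_coalgebra C (Dl Dr : C -> tensor C C) : Prop :=
  [/\ linear Dl /\ linear Dr,
      forall x, tmap id Dl (Dl x) = tmap id Dr (Dl x) /\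
                tmap id Dr (Dl x) = tassoc (tmap Dl id (Dl x)),
      forall x, tassoc (tmap Dr id (Dl x)) = tmap id Dl (Dr x)
    & forall x, tassoc (tmap Dl id (Dr x)) = tassoc (tmap Dr id (Dr x)) /\
                tassoc (tmap Dr id (Dr x)) = tmap id Dr (Dr x)].

Definition diassociative_bialgebra C (l r : C -> C -> C)
    (Dl Dr : C -> tensor C C) : Prop :=
  let u := op_bullet l r in
  let Du := fun x => Dr x - Dl x in
  [/\ diassociative_algebra l r,
      diassociative_coalgebra Dl Dr
    & forall x y,
  [/\ Dr (l x y) = tmap id (l x) (Dr y) - tmap (u^~ y) id (Dr x) /\
      Dr (l x y) = tmap id (l x) (Du y) + tmap (l^~ y) id (Dr x),
      tswap (tmap (r y) id (Dr x)) - tmap (l x) id (Du y) =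
      tmap (l x) id (Dl y) + tswap (tmap (u y) id (Dr x)) /\
      tmap (l x) id (Dl y) + tswap (tmap (u y) id (Dr x)) =
      tswap (tmap id (l^~ y) (Dr x)) + tmap id (u^~ x) (Du y),
      tswap (tmap id (r^~ y) (Dr x)) - tmap id (u^~ x) (Dl y) =
      tmap id (l^~ x) (Dl y) + tswap (tmap id (r^~ y) (Du x)) /\
      tmap id (l^~ x) (Dl y) + tswap (tmap id (r^~ y) (Du x)) =
      tmap (r x) id (Dl y) + tswap (tmap (u y) id (Du x)),
      Dl (r x y) = tmap id (r x) (Dl y) - tmap (r^~ y) id (Du x) /\
      Dl (r x y) = tmap id (u x) (Dl y) + tmap (r^~ y) id (Dl x)
    & Dl (l x y) = tmap (l^~ y) id (Dl x) - tmap id (u x) (Du y) /\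
      Dr (r x y) = tmap id (r x) (Dr y) - tmap (u^~ y) id (Du x)]].

Definition dia_left A B (m : A -> A -> A) (p : B -> B -> B) :
    tensor A B -> tensor A B -> tensor A B :=
  tensor_op m p.

Definition dia_right A B (m : A -> A -> A) (p : B -> B -> B) :
    tensor A B -> tensor A B -> tensor A B :=
  tensor_op m (fun a b => p b a).

Definition form_phi B (w : B -> B -> k) : 'Hom(B, dual B) :=
  linfun (fun a => linfun (w a : B -> k^o) : dual B).

Lemma form_phiE B (w : B -> B -> k) a b :
  bilinear_form w -> form_phi w a b = w a b.
Proof.
move=> bw; rewrite /form_phi linfun_lin; last exact: linfun_linear.
by rewrite linfun_lin //; case: bw.
Qed.

Lemma form_phi_bij B (w : B -> B -> k) : symplectic_form w ->
  cancel (form_phi w) (form_phi w)^-1%VF /\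
  cancel (form_phi w)^-1%VF (form_phi w).
Proof.
move=> [bw _ ndw]; apply: lfun_surj_bij; first by rewrite dim_dual.
have k0 : lker (form_phi w) = 0%VS.
  apply/eqP; rewrite -subv0; apply/subvP => a; rewrite memv_ker memv0 => /eqP e.
  apply/eqP/ndw => b; by rewrite -form_phiE // e zero_lfunE.
have gT : limg (form_phi w) = fullv.
  apply/eqP; rewrite -dimv_leqif_eq ?subvf // dim_dual.
  by rewrite -(limg_ker_dim (form_phi w) fullv) k0 capv0 dimv0.
move=> v; have: v \in limg (form_phi w) by rewrite gT memvf.
by case/memv_imgP => u _ ->; exists u.
Qed.

Definition perm_dual B (p : B -> B -> B) (w : B -> B -> k)
    (a b : dual B) : dual B :=
  form_phi w (p ((form_phi w)^-1%VF a) ((form_phi w)^-1%VF b)).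

Definition transport V W (f : 'Hom(V, W)) (m : V -> V -> V) (x y : W) : W :=
  f (m (f^-1%VF x) (f^-1%VF y)).

(* The operations on C^* = A^* (x) B^*, carried over to the dual of
   C = A (x) B along tdual. *)
Definition dia_left_dual A B (ms : dual A -> dual A -> dual A)
    (p : B -> B -> B) (w : B -> B -> k) :
    dual (tensor A B) -> dual (tensor A B) -> dual (tensor A B) :=
  transport tdual (dia_left ms (perm_dual p w)).

Definition dia_right_dual A B (ms : dual A -> dual A -> dual A)
    (p : B -> B -> B) (w : B -> B -> k) :
    dual (tensor A B) -> dual (tensor A B) -> dual (tensor A B) :=
  transport tdual (dia_right ms (perm_dual p w)).

Definition double_iso A B (w : B -> B -> k) :
    'Hom(tensor (dsum A) B, dsum (tensor A B)) :=
  linfun (tlift (fun (X : dsum A) (b : B) =>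
    ((tens X.1 b, tdual (tens X.2 (form_phi w b))) : dsum (tensor A B)))).

Lemma double_iso_linear A B (w : B -> B -> k) T :
  double_iso A w T = tlift (fun (X : dsum A) (b : B) =>
    ((tens X.1 b, tdual (tens X.2 (form_phi w b))) : dsum (tensor A B))) T.
Proof. by rewrite linfun_lin //; apply: tlift_linear. Qed.

Lemma double_iso_tens A B (w : B -> B -> k) (X : dsum A) (b : B) :
  double_iso A w (tens X b) = (tens X.1 b, tdual (tens X.2 (form_phi w b))).
Proof.
have [tl tr] := tens_bilinear A B.
have [dl dr] := tens_bilinear (dual A) (dual B).
rewrite double_iso_linear tlift_tens //.
split=> [c|Y] z u v; congr (_, _) => /=.
- exact: tl.
- by rewrite dl linearP.
- exact: tr.
- by rewrite linearP dr linearP.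
Qed.

Lemma double_isoE A B (w : B -> B -> k) (x : A) (y : dual A) (a b : B) :
  double_iso A w (tens ((x, 0) : dsum A) a + tens ((0, y) : dsum A) b) =
  (tens x a, tdual (tens y (form_phi w b))).
Proof.
rewrite linearD /= !double_iso_tens /=.
by rewrite !tens0l linear0; congr (_, _); rewrite ?addr0 ?add0r.
Qed.

Lemma double_iso_bij A B (w : B -> B -> k) : symplectic_form w ->
  cancel (double_iso A w) (double_iso A w)^-1%VF /\
  cancel (double_iso A w)^-1%VF (double_iso A w).
Proof.
move=> sw; have [_ phiK] := form_phi_bij sw; have [_ tdK] := tdual_bij A B.
apply: lfun_surj_bij.
  have ds V : \dim {:dsum V} = (\dim {:V} + \dim {:V})%N.
    have <- : (\dim {:V} + \dim {:dual V} = \dim {:V} + \dim {:V})%N.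
      by rewrite dim_dual.
    by rewrite !dimvf.
  by rewrite ds !dim_tensor ds mulnDl.
move=> [s z].
suff: ((s, z) : dsum (tensor A B)) \in limg (double_iso A w).
  by case/memv_imgP => u _ ->; exists u.
have -> : ((s, z) : dsum (tensor A B)) = (s, 0) + (0, z).
  by congr (_, _); rewrite ?addr0 ?add0r.
apply: memvD.
  have l1 : linear (fun t => (t, 0) : dsum (tensor A B)).
    by move=> c x y; congr (_, _); rewrite /= ?scaler0 ?addr0.
  rewrite (tens_sum s) (lin_sum2 _ _ l1).
  apply: memv_suml => i _; apply: memv_suml => j _; apply: memvZ.
  apply/memv_imgP; exists (tens (((vbasis fullv)`_i, 0) : dsum A)
    (vbasis fullv)`_j); first exact: memvf.
  by rewrite double_iso_tens /= tens0l linear0.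
have l2 : linear (fun T => (0, tdual T) : dsum (tensor A B)).
  by move=> c x y; congr (_, _); rewrite /= ?scaler0 ?addr0 ?linearP.
rewrite -(tdK z) (tens_sum (tdual^-1%VF z)) (lin_sum2 _ _ l2).
apply: memv_suml => i _; apply: memv_suml => j _; apply: memvZ.
apply/memv_imgP; exists (tens ((0, (vbasis fullv)`_i) : dsum A)
  ((form_phi w)^-1%VF (vbasis fullv)`_j)); first exact: memvf.
by rewrite double_iso_tens /= tens0l phiK.
Qed.

Definition dia_left_double A B (md : dsum A -> dsum A -> dsum A)
    (p : B -> B -> B) (w : B -> B -> k) :
    dsum (tensor A B) -> dsum (tensor A B) -> dsum (tensor A B) :=
  transport (double_iso A w) (dia_left md p).

Definition dia_right_double A B (md : dsum A -> dsum A -> dsum A)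
    (p : B -> B -> B) (w : B -> B -> k) :
    dsum (tensor A B) -> dsum (tensor A B) -> dsum (tensor A B) :=
  transport (double_iso A w) (dia_right md p).

End Structures.

(* Main.v *)
(* Write w = omega_d, l = -|, r = |-, u = r - l on C + C^*.  A Manin triple makes C
   a bialgebra because the three trilinear forms w(l X Y, Z), w(r X Y, Z) and
   w(u X Y, Z) are cyclic rotations of one another up to sign.  Paired with
   a (x) b, a term such as (r(-, y) (x) id) Delta(x) becomes, up to sign, Z.2 P.1
   with Z a product of a and y and P a product of b and x in C + C^*; two such
   terms add up to w(P, Z) = P.2 Z.1 - Z.2 P.1, and each compatibility condition
   becomes, after a rotation, a diassociativity identity in C + C^*.

   For the Manin triple itself, omega_d pulled back along f is B_s * omega on
   pure tensors, so the invariance of B_s and that of omega combine. *)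
Require Import Defs.
From mathcomp Require Import all_boot all_order all_algebra.
From mathcomp Require Import ring.
Set Implicit Arguments.
Unset Strict Implicit.
Unset Printing Implicit Defensive.
Import GRing.Theory.
Local Open Scope ring_scope.

(** * Linear and bilinear maps *)

Lemma linear_sub (k : fieldType) (V W : vectType k) (g : V -> W) x y :
  linear g -> g (x - y) = g x - g y.
Proof. by move=> lg; rewrite addrC -scaleN1r lg scaleN1r addrC. Qed.

Lemma inl_linear (k : fieldType) (V : vectType k) :
  linear (fun x : V => ((x, 0) : dsum V)).
Proof. by move=> c x y; congr (_, _); rewrite /= ?scaler0 ?addr0. Qed.

Lemma inr_linear (k : fieldType) (V : vectType k) :
  linear (fun a : dual V => ((0, a) : dsum V)).
Proof. by move=> c x y; congr (_, _); rewrite /= ?scaler0 ?addr0. Qed.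

Lemma op_bullet_bilinear (k : fieldType) (V : vectType k) (l r : V -> V -> V) :
  bilinear_op l -> bilinear_op r -> bilinear_op (op_bullet l r).
Proof.
move=> [ll lr] [rl rr]; rewrite /op_bullet; split=> [y|x] c s t /=.
  by rewrite ll rl scalerBr addrACA -opprD.
by rewrite lr rr scalerBr addrACA -opprD.
Qed.

(** * Duality between tensors, and between coproducts and products *)

Section Pairing.
Variable k : fieldType.
Implicit Types U V W : vectType k.

(** The transpose of [g] at [a]; as [g] is a bare function, [dcompE] controls the values for linear
    [g]. *)
Definition dcomp U V (a : dual V) (g : U -> V) : dual U :=
  linfun ((fun u => a (g u)) : U -> k^o).

Lemma dcompE U V (a : dual V) (g : U -> V) u :
  linear g -> dcomp a g u = a (g u).
Proof. by move=> lg; rewrite linfun_lin // => c x y; rewrite lg linearP. Qed.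

Lemma tmap_bilinear U V U' V' (g : U -> U') (h : V -> V') :
  linear g -> linear h -> bilinear_op (fun u v => tens (g u) (h v)).
Proof.
have [tl tr] := tens_bilinear U' V'.
by move=> lg lh; split=> [v|u] c x y; rewrite ?lg ?lh ?tl ?tr.
Qed.

Lemma tmap_tens U V U' V' (g : U -> U') (h : V -> V') u v :
  linear g -> linear h -> tmap g h (tens u v) = tens (g u) (h v).
Proof. by move=> lg lh; rewrite /tmap tlift_tens //; apply: tmap_bilinear. Qed.

(** Moves maps acting on the legs of a tensor onto the functionals paired with it. Both sides are
    linear in [t], so pure tensors suffice. *)
Lemma tpair_tmap U V U' V' (g : U -> U') (h : V -> V') a b t :
  linear g -> linear h ->
  tpair (tens a b) (tmap g h t) = tpair (tens (dcomp a g) (dcomp b h)) t.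
Proof.
move=> lg lh; move: t; apply: tens_ext => [c s t|c s t|u v].
- by rewrite [tmap _ _ _]tlift_linear tpair_linearr.
- by rewrite tpair_linearr.
- by rewrite tmap_tens // !tpair_tens !dcompE.
Qed.

Lemma tpair_tswap U V (a : dual V) (b : dual U) t :
  tpair (tens a b) (tswap t) = tpair (tens b a) t.
Proof.
have [tl tr] := tens_bilinear V U.
move: t; apply: tens_ext => [c s t|c s t|u v].
- by rewrite [tswap _]tlift_linear tpair_linearr.
- by rewrite tpair_linearr.
- by rewrite /tswap tlift_tens ?tpair_tens 1?mulrC //; split.
Qed.

(** The matrix entries of a tensor are its pairings with tensors of dual basis vectors. *)
Lemma tpair_sep U V (s t : tensor U V) :
  (forall a b, tpair (tens a b) s = tpair (tens a b) t) -> s = t.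
Proof.
have E (r : tensor U V) i j : (r : 'M_(_, _)) i j =
    tpair (tens (dual_basis i) (dual_basis j)) r.
  rewrite {2}(tens_sum r) pair_bigA (lin_sum _ _ _ _ (tpair_linearr _)) /=.
  rewrite (bigD1 (i, j)) //= big1 => [|[i' j'] /= ne].
    rewrite addr0 tpair_tens !lfunE /= !coord_free ?(basis_free (vbasisP _)) //.
    by rewrite !eqxx mulr1 [RHS]mulr1.
  rewrite tpair_tens !lfunE /= !coord_free ?(basis_free (vbasisP _)) //.
  by rewrite -natrM mulnb -xpair_eqE (negPf ne) [LHS]mulr0.
by move=> h; apply/matrixP => i j; rewrite !E.
Qed.

(** Every functional on the inner tensor product is some [tdual T], and both pairings are linear in
    [T], so pure [T] suffice. *)
Lemma tpair_sep3 U V W (s t : tensor U (tensor V W)) :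
  (forall a b c, tpair (tens a (tdual (tens b c))) s =
                 tpair (tens a (tdual (tens b c))) t) -> s = t.
Proof.
move=> h; apply: tpair_sep => a z; have [T <-] := tdual_surj z.
have [_ tr] := tens_bilinear (dual U) (dual (tensor V W)).
have lp (r : tensor U (tensor V W)) :
    linear (fun T => tpair (tens a (tdual T)) r : k^o).
  by move=> c x y; rewrite linearP tr; exact: tlift_linear.
by move: T; apply: tens_ext.
Qed.

Section Coproduct.
Variables (V : vectType k) (D : V -> tensor V V).
Variable m : dual V -> dual V -> dual V.
Hypotheses (lD : linear D) (hD : is_linear_dual D m).

(** A coproduct applied to one leg dualizes to the product of the two functionals facing that leg,
    so coalgebra identities become identities of [m]. *)
Lemma tpair_coproductr U (a : dual U) b c t :
  tpair (tens a (tdual (tens b c))) (tmap id D t) = tpair (tens a (m b c)) t.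
Proof.
rewrite tpair_tmap //; congr (tpair (tens _ _) _); apply/lfunP => x.
  by rewrite dcompE.
by rewrite dcompE // tdualE hD.
Qed.

Lemma tpair_coproductl W a b (c : dual W) t :
  tpair (tens a (tdual (tens b c))) (tassoc (tmap D id t)) =
  tpair (tens (m a b) c) t.
Proof.
have [tl tr] := tens_bilinear V (tensor V W).
have [tl' tr'] := tens_bilinear V W.
have lass : linear (@tassoc k V V W) by exact: tlift_linear.
move: t; apply: tens_ext => [e s t|e s t|u w].
- by rewrite [tmap _ _ _]tlift_linear lass tpair_linearr.
- by rewrite tpair_linearr.
rewrite tmap_tens // tpair_tens -hD /tassoc tlift_tens; last first.
  split=> [w'|s] e x y; first exact: tlift_linear.
  by rewrite -tlift_comb; apply: tlift_eq => u' v'; rewrite tr' tr.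
(* Both sides are linear in the tensor [D u], which is therefore generalized and then taken pure. *)
move: (D u); apply: tens_ext => [e s t|e s t|u' v'].
- by rewrite tlift_linear tpair_linearr.
- by rewrite tpair_linearr mulrDl -scalerAl.
rewrite tlift_tens; first by rewrite !tpair_tens tdual_tens mulrA.
by split=> [v1|u1] e x y; rewrite ?tl' ?tl ?tr.
Qed.

End Coproduct.

(** Uniqueness identifies [D] with the explicit coproduct [linear_dual m], which is linear. *)
Lemma is_linear_dual_linear V (D : V -> tensor V V) m :
  bilinear_op m -> is_linear_dual D m -> linear D.
Proof.
move=> bm hD; have [lD' hD'] := linear_dualP bm.
by move=> c x y; rewrite !(linear_dual_uniq hD hD') lD'.
Qed.

End Pairing.

(** * Restriction of diassociative structures along injective linear maps *)

Section Subalgebra.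
Variables (k : fieldType) (V W : vectType k) (e : V -> W).
Hypotheses (le : linear e) (ie : injective e).
Variables (l r : W -> W -> W) (l' r' : V -> V -> V).
Hypotheses (hl : forall x y, l (e x) (e y) = e (l' x y))
  (hr : forall x y, r (e x) (e y) = e (r' x y)).

Lemma bilinear_restrict (m : W -> W -> W) (m' : V -> V -> V) :
  (forall x y, m (e x) (e y) = e (m' x y)) -> bilinear_op m -> bilinear_op m'.
Proof.
move=> hm [ml mr]; split=> [y|x] c u v; apply: ie.
  by rewrite le -!hm le ml.
by rewrite le -!hm le mr.
Qed.

(** Identities are pushed into [W] by [e] and pulled back by injectivity. This serves both for the
    two halves of a Manin triple and for transport along an isomorphism. *)
Lemma diassociative_restrict :
  diassociative_algebra l r -> diassociative_algebra l' r'.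
Proof.
move=> [[bl br] h1 h2 h3]; split.
- by split; [exact: bilinear_restrict hl bl | exact: bilinear_restrict hr br].
- move=> x y z; have [p q] := h1 (e x) (e y) (e z).
  by split; apply: ie; move: p q; rewrite ?(hl, hr).
- by move=> x y z; apply: ie; move: (h2 (e x) (e y) (e z)); rewrite ?(hl, hr).
- move=> x y z; have [p q] := h3 (e x) (e y) (e z).
  by split; apply: ie; move: p q; rewrite ?(hl, hr).
Qed.

End Subalgebra.

(** * From a standard Manin triple to a diassociative bialgebra *)

Section ManinTriple.
Variables (k : fieldType) (C : vectType k).
Variables (l r : dsum C -> dsum C -> dsum C).
Variables (lC rC : C -> C -> C) (lCs rCs : dual C -> dual C -> dual C).
Hypothesis mt : standard_Manin_triple l r lC rC lCs rCs.

Let w := @form_d k C.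
Let u := op_bullet l r.
Let inC (x : C) : dsum C := (x, 0).
Let inD (a : dual C) : dsum C := (0, a).

Lemma Manin_triple_subalgebra : diassociative_algebra lC rC.
Proof.
have [[da _ _ _] [el _] [er _]] := mt.
apply: (diassociative_restrict (e := inC) _ _ _ _ da) => //.
  exact: inl_linear.
by move=> x y [].
Qed.

Lemma Manin_triple_subalgebra_dual : diassociative_algebra lCs rCs.
Proof.
have [[da _ _ _] [_ el] [_ er]] := mt.
apply: (diassociative_restrict (e := inD) _ _ _ _ da) => //.
  exact: inr_linear.
by move=> x y [].
Qed.

Let asym X Y : w X Y = - w Y X.
Proof. by rewrite /w /form_d opprB. Qed.

Let invl X Y Z : w X (l Y Z) = w Z (u X Y).
Proof. by have [[_ _ h _] _ _] := mt; exact: h. Qed.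
Let invr X Y Z : w (r X Y) Z = w X (u Y Z).
Proof. by have [[_ _ _ h] _ _] := mt; exact: h. Qed.

Let u_l X Y Z : w (u X Y) Z = w (l Y Z) X.
Proof. by rewrite asym -invl -asym. Qed.
Let r_u X Y Z : w (r X Y) Z = - w (u Y Z) X.
Proof. by rewrite invr asym. Qed.
Let r_l X Y Z : w (r X Y) Z = - w (l Z X) Y.
Proof. by rewrite r_u u_l. Qed.

(** Pairing with an element of one summand reads off a single component; this is how evaluations of
    functionals enter and leave [w]. *)
Let wD a X : w (inD a) X = a X.1.
Proof. by rewrite /w /form_d /= linear0 subr0. Qed.
Let wC x X : w X (inC x) = X.2 x.
Proof. by rewrite /w /form_d /= zero_lfunE subr0. Qed.
Let wE X Y : w X Y = X.2 Y.1 - Y.2 X.1.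
Proof. by []. Qed.

Let lCE x y : l (inC x) (inC y) = inC (lC x y).
Proof. by have [_ [h _] _] := mt; exact: h. Qed.
Let rCE x y : r (inC x) (inC y) = inC (rC x y).
Proof. by have [_ _ [h _]] := mt; exact: h. Qed.
Let lDE x y : l (inD x) (inD y) = inD (lCs x y).
Proof. by have [_ [_ h] _] := mt; exact: h. Qed.
Let rDE x y : r (inD x) (inD y) = inD (rCs x y).
Proof. by have [_ _ [_ h]] := mt; exact: h. Qed.

Let uC := op_bullet lC rC.
Let uCs := op_bullet lCs rCs.

Let uCE x y : u (inC x) (inC y) = inC (uC x y).
Proof. by rewrite /u /op_bullet lCE rCE; congr (_, _); exact: subr0. Qed.
Let uDE x y : u (inD x) (inD y) = inD (uCs x y).
Proof. by rewrite /u /op_bullet lDE rDE; congr (_, _); exact: subr0. Qed.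

Let bilC : bilinear_op lC /\ bilinear_op rC.
Proof. by have [] := Manin_triple_subalgebra. Qed.

Let biluC : bilinear_op uC.
Proof. by apply: op_bullet_bilinear; have [] := bilC. Qed.

Let bilCs : bilinear_op lCs /\ bilinear_op rCs.
Proof. by have [] := Manin_triple_subalgebra_dual. Qed.

Let Llin x : linear (lC x). Proof. by have [[]] := bilC. Qed.
Let Rlin x : linear (rC x). Proof. by have [_ []] := bilC. Qed.
Let Ulin x : linear (uC x). Proof. by have [] := biluC. Qed.
Let Llin' x : linear (lC^~ x). Proof. by have [[]] := bilC. Qed.
Let Rlin' x : linear (rC^~ x). Proof. by have [_ []] := bilC. Qed.
Let Ulin' x : linear (uC^~ x). Proof. by have [] := biluC. Qed.

(** Transposed multiplications of [C] are dual components of mixed products: [a (lC x z)] equals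
    [w (inD a) (l (inC x) (inC z))], and a rotation isolates [inC z]. *)
Let comp_l a x : dcomp a (lC x) = - (u (inD a) (inC x)).2.
Proof.
apply/lfunP => z; rewrite dcompE // opp_lfunE -wC -(wD a (inC _)) -lCE.
by rewrite invl asym.
Qed.
Let comp_l' a x : dcomp a (lC^~ x) = (r (inC x) (inD a)).2.
Proof.
apply/lfunP => z; rewrite dcompE // -wC -(wD a (inC _)) -lCE.
by rewrite invl -invr.
Qed.
Let comp_r a x : dcomp a (rC x) = (l (inD a) (inC x)).2.
Proof.
apply/lfunP => z; rewrite dcompE // -wC -(wD a (inC _)) -rCE.
by rewrite asym r_l opprK.
Qed.
Let comp_r' a x : dcomp a (rC^~ x) = (u (inC x) (inD a)).2.
Proof.
apply/lfunP => z; rewrite dcompE // -wC -(wD a (inC _)) -rCE.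
by rewrite asym r_u opprK.
Qed.
Let comp_u a x : dcomp a (uC x) = (r (inD a) (inC x)).2.
Proof.
apply/lfunP => z; rewrite dcompE // -wC -(wD a (inC _)) -uCE.
by rewrite -invr.
Qed.
Let comp_u' a x : dcomp a (uC^~ x) = - (l (inC x) (inD a)).2.
Proof.
apply/lfunP => z; rewrite dcompE // opp_lfunE -wC -(wD a (inC _)) -uCE.
by rewrite asym u_l.
Qed.

(** The dual counterpart: rotations express products in the dual of [C] through [C]-components of
    mixed products. Unprimed versions isolate [a], primed ones [b]. *)
Let evall a b x : lCs a b x = a (r (inD b) (inC x)).1.
Proof. by rewrite -wD -(wC x (inD _)) -lDE [RHS]asym r_l opprK. Qed.
Let evalr a b x : rCs a b x = a (u (inD b) (inC x)).1.
Proof. by rewrite -wD -(wC x (inD _)) -rDE invr. Qed.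
Let evalu a b x : uCs a b x = - a (l (inD b) (inC x)).1.
Proof. by rewrite -wD -(wC x (inD _)) -uDE u_l [LHS]asym. Qed.
Let evall' a b x : lCs a b x = - b (u (inC x) (inD a)).1.
Proof. by rewrite -wD -(wC x (inD _)) -lDE -u_l [LHS]asym. Qed.
Let evalr' a b x : rCs a b x = b (l (inC x) (inD a)).1.
Proof. by rewrite -wD -(wC x (inD _)) -rDE r_l [RHS]asym. Qed.
Let evalu' a b x : uCs a b x = b (r (inC x) (inD a)).1.
Proof. by rewrite -wD -(wC x (inD _)) -uDE [RHS]asym r_u opprK. Qed.

Variables Dl Dr : C -> tensor C C.
Hypotheses (hDl : is_linear_dual Dl lCs) (hDr : is_linear_dual Dr rCs).

Let lDl : linear Dl.
Proof. by apply: is_linear_dual_linear hDl; have [] := bilCs. Qed.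
Let lDr : linear Dr.
Proof. by apply: is_linear_dual_linear hDr; have [] := bilCs. Qed.

(** Tested on three functionals, each coalgebra axiom is an axiom of the diassociative algebra on
    the dual of [C]. *)
Lemma Manin_triple_coalgebra : diassociative_coalgebra Dl Dr.
Proof.
have [_ h1 h2 h3] := Manin_triple_subalgebra_dual.
have pr := (tpair_coproductr lDl hDl, tpair_coproductr lDr hDr,
            tpair_coproductl lDl hDl, tpair_coproductl lDr hDr).
split=> // x; [split | | split]; apply: tpair_sep3 => a b c;
  rewrite !pr ?hDl ?hDr; have [e1 e1'] := h1 a b c;
  have [e3 e3'] := h3 a b c; rewrite ?h2 //.
- by rewrite e1'.
- by rewrite -e1' e1.
- by rewrite e3.
- by rewrite e3 e3'.
Qed.

Let Du x := Dr x - Dl x.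

Let tB a b (s t : tensor C C) :
  tpair (tens a b) (s - t) = tpair (tens a b) s - tpair (tens a b) t.
Proof. exact: (linear_sub _ _ (tpair_linearr _)). Qed.
Let tD a b (s t : tensor C C) :
  tpair (tens a b) (s + t) = tpair (tens a b) s + tpair (tens a b) t.
Proof. by rewrite -[s]scale1r tpair_linearr !scale1r. Qed.

Let hDu : is_linear_dual Du uCs.
Proof. by move=> x a b; rewrite tB hDl hDr /uCs add_lfunE opp_lfunE. Qed.

Let dcomp_id (a : dual C) : dcomp a id = a.
Proof. by apply/lfunP => x; rewrite dcompE. Qed.

(** In these names [l], [r], [u] selects the coproduct and [L], [R] the leg on which [g] acts. The
    leg decides between the unprimed and primed evaluation rules, so that the transposed functional
    is the isolated one. *)
Let TlL a b (g : C -> C) x : linear g ->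
  tpair (tens a b) (tmap g id (Dl x)) = dcomp a g (r (inD b) (inC x)).1.
Proof. by move=> lg; rewrite tpair_tmap // dcomp_id hDl evall. Qed.
Let TrL a b (g : C -> C) x : linear g ->
  tpair (tens a b) (tmap g id (Dr x)) = dcomp a g (u (inD b) (inC x)).1.
Proof. by move=> lg; rewrite tpair_tmap // dcomp_id hDr evalr. Qed.
Let TuL a b (g : C -> C) x : linear g ->
  tpair (tens a b) (tmap g id (Du x)) = - dcomp a g (l (inD b) (inC x)).1.
Proof. by move=> lg; rewrite tpair_tmap // dcomp_id hDu evalu. Qed.
Let TlR a b (g : C -> C) x : linear g ->
  tpair (tens a b) (tmap id g (Dl x)) = - dcomp b g (u (inC x) (inD a)).1.
Proof. by move=> lg; rewrite tpair_tmap // dcomp_id hDl evall'. Qed.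
Let TrR a b (g : C -> C) x : linear g ->
  tpair (tens a b) (tmap id g (Dr x)) = dcomp b g (l (inC x) (inD a)).1.
Proof. by move=> lg; rewrite tpair_tmap // dcomp_id hDr evalr'. Qed.
Let TuR a b (g : C -> C) x : linear g ->
  tpair (tens a b) (tmap id g (Du x)) = dcomp b g (r (inC x) (inD a)).1.
Proof. by move=> lg; rewrite tpair_tmap // dcomp_id hDu evalu'. Qed.

Let TE := (tB, tD, tpair_tswap).
Let ME := (TlL, TrL, TuL, TlR, TrR, TuR).
Let CE := (comp_l, comp_l', comp_r, comp_r', comp_u, comp_u').

Let wN (P Z : dsum C) : - Z.2 P.1 + P.2 Z.1 = w P Z.
Proof. by rewrite addrC. Qed.

Let dD : diassociative_algebra l r. Proof. by have [[]] := mt. Qed.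
Let ll X Y Z : l X (l Y Z) = l X (r Y Z).
Proof. by have [_ h _ _] := dD; have [] := h X Y Z. Qed.
Let ll' X Y Z : l (l X Y) Z = l X (r Y Z).
Proof. by have [_ h _ _] := dD; have [-> ->] := h X Y Z. Qed.
Let lr X Y Z : l (r X Y) Z = r X (l Y Z).
Proof. by have [_ _ h _] := dD. Qed.
Let rr X Y Z : r (r X Y) Z = r X (r Y Z).
Proof. by have [_ _ _ h] := dD; have [-> ->] := h X Y Z. Qed.
Let rl X Y Z : r (l X Y) Z = r X (r Y Z).
Proof. by have [_ _ _ h] := dD; have [_ ->] := h X Y Z. Qed.

Let lBr X Y Z : l X (Y - Z) = l X Y - l X Z.
Proof. by apply: linear_sub; have [[[]]] := dD. Qed.
Let lBl X Y Z : l (X - Y) Z = l X Z - l Y Z.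
Proof. by apply: (linear_sub (g := l^~ Z)); have [[[]]] := dD. Qed.
Let rBr X Y Z : r X (Y - Z) = r X Y - r X Z.
Proof. by apply: linear_sub; have [[_ []]] := dD. Qed.
Let rBl X Y Z : r (X - Y) Z = r X Z - r Y Z.
Proof. by apply: (linear_sub (g := r^~ Z)); have [[_ []]] := dD. Qed.

(** A rewriting system: differences are expanded and triple products reach one of the forms
    [l X (r Y Z)], [r X (l Y Z)], [r X (r Y Z)]. *)
Let dE := (lBr, lBl, rBr, rBl, ll', lr, rr, rl, ll).

Let u_ul X Y Z : u (u X Y) Z = - u X (l Y Z).
Proof. by rewrite /u /op_bullet !dE subrr sub0r. Qed.
Let u_ru X Y Z : u X (u Y Z) = u (r X Y) Z.
Proof. by rewrite /u /op_bullet !dE subrr subr0. Qed.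
Let u_lr X Y Z : u (l X Y) Z = u X (r Y Z).
Proof. by rewrite /u /op_bullet !dE. Qed.

Let evC (c : dual C) x : c x = w (inD c) (inC x).
Proof. by rewrite wD. Qed.
Let wNl X Y : w (- X) Y = - w X Y.
Proof. by rewrite !wE /= opp_lfunE linearN opprD. Qed.

Lemma Manin_triple_bialgebra : diassociative_bialgebra lC rC Dl Dr.
Proof.
split; [exact: Manin_triple_subalgebra | exact: Manin_triple_coalgebra |].
rewrite -/uC -/Du => x y; split; first split.
all: try split.
all: apply: tpair_sep => a b; rewrite !TE !ME // !CE ?opp_lfunE.
(* Pairs of terms fold into one value of [w], in whichever order the two summands occur. *)
all: rewrite ?opprK ?wN -?wE.
(* A coproduct of a product in [C] becomes a product of [a] and [b] evaluated at that product; [evC]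
   then writes it as a value of [w]. *)
all: rewrite ?(hDl, hDr).
(* The ten goals are conditions (1) to (6) in order, two equalities for each of (1) to (4). *)
- by rewrite evC -rDE -lCE r_u -u_l u_ul wNl.
- by rewrite evC -rDE -lCE r_l [RHS]asym u_l ll'.
- by rewrite asym u_l ll -u_l -asym.
- by rewrite invr [RHS]asym -u_l u_ru -asym.
- by rewrite !u_l ll.
- by rewrite u_l [RHS]asym r_l opprK ll'.
- by rewrite evC -lDE -rCE -[LHS]opprK -r_l u_l -[RHS]opprK -r_l rl.
- by rewrite evC -lDE -rCE -[LHS]opprK -r_l u_l -[RHS]opprK -r_l rr.
- by rewrite evC -lDE -lCE -u_l [RHS]asym invr -asym u_lr.
by rewrite evC -rDE -rCE r_u [RHS]asym -u_l u_lr.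
Qed.

End ManinTriple.

(** * Multilinear maps on tensors, tensor product operations and transport *)

Section TensorOp.
Variable k : fieldType.
Implicit Types U V W X Y : vectType k.

Definition trilinear_op U V W X (g : U -> V -> W -> X) : Prop :=
  (forall w, bilinear_op (fun u v => g u v w)) /\ (forall u v, linear (g u v)).

Lemma bilinear_flip U V W (m : U -> V -> W) :
  bilinear_op m -> bilinear_op (fun v u => m u v).
Proof. by case. Qed.

Lemma trilinear_compl U V W X Y (m : U -> V -> X) (n : X -> W -> Y) :
  bilinear_op m -> bilinear_op n -> trilinear_op (fun x y z => n (m x y) z).
Proof.
move=> [ml mr] [nl nr]; split=> [z|x y c s t]; last exact: nr.
by split=> [y|x] c s t /=; rewrite ?ml ?mr nl.
Qed.

Lemma trilinear_compr U V W X Y (m : V -> W -> X) (n : U -> X -> Y) :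
  bilinear_op m -> bilinear_op n -> trilinear_op (fun x y z => n x (m y z)).
Proof.
move=> [ml mr] [nl nr]; split=> [z|x y c s t]; last by rewrite mr nr.
by split=> [y|x] c s t /=; rewrite ?ml ?nl ?nr.
Qed.

Lemma tens_ext2 U V U' V' X (g h : tensor U V -> tensor U' V' -> X) :
  bilinear_op g -> bilinear_op h ->
  (forall x a y b, g (tens x a) (tens y b) = h (tens x a) (tens y b)) ->
  g =2 h.
Proof.
move=> [gl gr] [hl hr] gh s t; move: s.
apply: tens_ext => // x a; move: t; exact: tens_ext.
Qed.

Lemma tens_ext3 U V U' V' U'' V'' X
    (g h : tensor U V -> tensor U' V' -> tensor U'' V'' -> X) :
  trilinear_op g -> trilinear_op h ->
  (forall x a y b z c, g (tens x a) (tens y b) (tens z c) =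
                       h (tens x a) (tens y b) (tens z c)) ->
  forall s t v, g s t v = h s t v.
Proof.
move=> [gl gr] [hl hr] gh s t v.
apply: (tens_ext2 (gl v) (hl v)) => x a y b; move: v; exact: tens_ext.
Qed.

(** [tlift] is linear in its tensor whatever function it lifts. *)
Lemma tensor_op_bilinear U V (m : U -> U -> U) (n : V -> V -> V) :
  bilinear_op (tensor_op m n).
Proof.
split=> [t|s] c x y; first exact: tlift_linear.
by rewrite /tensor_op -tlift_comb; apply: tlift_eq => u v; exact: tlift_linear.
Qed.

(** On pure tensors the first factors agree by associativity. In the second, [p2] brackets to the
    right; both sides then start with the same letter, and [p1] lets the other two commute. *)
Lemma dia_tensor U V (m : U -> U -> U) (p : V -> V -> V) :
  associative_algebra m -> perm_algebra p ->
  diassociative_algebra (dia_left m p) (dia_right m p).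
Proof.
move=> [bm am] [bp hp].
have bq := bilinear_flip bp.
have [bl br] : bilinear_op (dia_left m p) /\ bilinear_op (dia_right m p).
  by split; exact: tensor_op_bilinear.
have E : (forall x a y b, dia_left m p (tens x a) (tens y b)
                          = tens (m x y) (p a b)) *
         (forall x a y b, dia_right m p (tens x a) (tens y b)
                          = tens (m x y) (p b a)).
  by split=> x a y b; rewrite [LHS]tensor_op_tens.
have p1 x y z : p x (p y z) = p x (p z y) by have [] := hp x y z.
have p2 x y z : p (p x y) z = p x (p y z) by have [] := hp x y z.
split=> // s t v; [split | | split]; move: s t v;
  (apply: tens_ext3;
    [by (apply: trilinear_compl || apply: trilinear_compr)..|])
    => x a y b z c;
  rewrite !E -?am ?p2 //; congr (tens _ _); exact: p1.

Qed.

(** The inverse of [f] is an injective morphism from the transported operations to the original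
    ones. *)
Lemma dia_transport U V (f : 'Hom(U, V)) (l r : U -> U -> U) :
  cancel f f^-1%VF -> cancel f^-1%VF f -> diassociative_algebra l r ->
  diassociative_algebra (transport f l) (transport f r).
Proof.
move=> fK fVK; apply: (diassociative_restrict (e := f^-1%VF)).
- by move=> c x y; rewrite linearP.
- exact: can_inj fVK.
- by move=> x y; rewrite /transport fK.
- by move=> x y; rewrite /transport fK.
Qed.

Lemma form_d_symplectic V : symplectic_form (@form_d k V).
Proof.
split.
- split=> [Y|X] c Z T; rewrite /form_d /= linearP add_lfunE scale_lfunE /=;
  by rewrite /GRing.scale /=; ring.
- by move=> X Y; rewrite /form_d opprB.
(* Testing against [(0, dual_basis i)] kills the coordinates of [x], and testing against [(y, 0)]
   kills [a]. *)
move=> [x a] h; congr (_, _).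
  rewrite [x](coord_vbasis (memvf x)) big1 // => i _.
  have := h (0, dual_basis i); rewrite /form_d /= linear0 sub0r lfunE /=.
  by move/eqP; rewrite oppr_eq0 => /eqP ->; rewrite scale0r.
by apply/lfunP => y; have := h (y, 0); rewrite /form_d /= !zero_lfunE subr0.
Qed.

End TensorOp.

(** * The two subalgebras of the transported double *)

Section Double.
Variables (k : fieldType) (A B : vectType k).
Variables (mA : A -> A -> A) (mAs : dual A -> dual A -> dual A).
Variables (md : dsum A -> dsum A -> dsum A) (w : B -> B -> k).
Hypotheses (sw : symplectic_form w) (bd : bilinear_op md)
  (ed : extends_ops md mA mAs).

Let f := double_iso A w.

Lemma extends_bilinear : bilinear_op mA /\ bilinear_op mAs.
Proof.
have [h1 h2] := ed; split.
  by apply: (bilinear_restrict (inl_linear (V := A)) _ h1 bd) => x y [].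
by apply: (bilinear_restrict (inr_linear (V := A)) _ h2 bd) => x y [].
Qed.

(** An arbitrary bilinear [n] covers both the perm product and its opposite, hence both
    diassociative operations. *)
Lemma extends_tensor (n : B -> B -> B) : bilinear_op n ->
  extends_ops (transport f (tensor_op md n)) (tensor_op mA n)
    (transport tdual (tensor_op mAs (fun a b =>
       form_phi w (n ((form_phi w)^-1%VF a) ((form_phi w)^-1%VF b))))).
Proof.
move=> bn; have [bA bAs] := extends_bilinear.
have [edl edr] := ed.
have [fK fVK] := double_iso_bij A sw.
have [phiK phiVK] := form_phi_bij sw.
have [tdK tdVK] := tdual_bij A B.
have lvphi : linear (form_phi w)^-1%VF by move=> c x y; rewrite linearP.
pose n' := fun a b =>
  form_phi w (n ((form_phi w)^-1%VF a) ((form_phi w)^-1%VF b)).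
have bn' : bilinear_op n'.
  have [nl nr] := bn.
  by split=> [b|a] c x y; rewrite /n' lvphi ?nl ?nr linearP.
have [l1 l2] := (inl_linear (V := A), inr_linear (V := A)).
have [L1 L2] := (inl_linear (V := tensor A B), inr_linear (V := tensor A B)).
have lf : linear f by move=> c x y; rewrite linearP.
have ltd : linear (@tdual k A B) by move=> c x y; rewrite linearP.
have [opl opr] := tensor_op_bilinear md n.
split.
  pose i : tensor A B -> tensor (dsum A) B :=
    tmap (fun x => (x, 0) : dsum A) id.
  have li : linear i by exact: tlift_linear.
  have fi s : f (i s) = (s, 0).
    move: s; apply: tens_ext => // [c x y|x a]; first by rewrite li lf.
    by rewrite /i tmap_tens // /f double_iso_tens /= tens0l linear0.
  (* Writing the arguments as images under [f] cancels the inverse in [transport]. *)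
  move=> s t; rewrite /transport -!fi !fK fi; move: s t; apply: tens_ext2.
  - by split=> [t|s] c x y; rewrite li ?opl ?opr lf.
  - have [ol or] := tensor_op_bilinear mA n.
    by split=> [t|s] c x y; rewrite ?ol ?or L1.
  move=> x a y b; rewrite /i !tmap_tens // !tensor_op_tens // edl.
  by rewrite /f double_iso_tens /= tens0l linear0.
(* The inverse of [form_phi w] compensates for the [form_phi w] that [f] applies to the second
   factor. *)
pose j : tensor (dual A) (dual B) -> tensor (dsum A) B :=
  tmap (fun x => (0, x) : dsum A) (form_phi w)^-1%VF.
have lj : linear j by exact: tlift_linear.
have fj s : f (j s) = (0, tdual s).
  move: s; apply: tens_ext => // [c x y|c x y|x a].
  - by rewrite lj lf.
  - by rewrite ltd L2.
  by rewrite /j tmap_tens // /f double_iso_tens /= tens0l phiVK.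
move=> a b; have [s <-] := tdual_surj a; have [t <-] := tdual_surj b.
rewrite -/n' /transport -!fj !fK !tdK fj; move: s t {a b}; apply: tens_ext2.
- by split=> [t|s] c x y; rewrite lj ?opl ?opr lf.
- have [ol or] := tensor_op_bilinear mAs n'.
  by split=> [t|s] c x y; rewrite ?ol ?or ltd L2.
move=> x a y b; rewrite /j !tmap_tens // !tensor_op_tens // edr.
by rewrite /f double_iso_tens /= tens0l.
Qed.

End Double.

(** * Invariance of the form on the double *)

Section Quadratic.
Variables (k : fieldType) (A B : vectType k).
Variables (mA : A -> A -> A) (mAs : dual A -> dual A -> dual A).
Variables (md : dsum A -> dsum A -> dsum A) (p : B -> B -> B) (w : B -> B -> k).
Hypotheses (dc : double_construction md mA mAs) (qp : quadratic_perm p w).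

Let f := double_iso A w.

(** Antisymmetry of [w] absorbs the minus sign of [form_d], which leaves the symmetric [form_s]. *)
Lemma form_d_double_iso X a Y b :
  form_d (f (tens X a)) (f (tens Y b)) = form_s X Y * w a b.
Proof.
have [_ [bw aw _] _] := qp.
rewrite /f !double_iso_tens /form_d /form_s /= !tdual_tens !form_phiE //.
by rewrite (aw b a); ring.
Qed.

Lemma double_quadratic :
  quadratic_diassociative (dia_left_double md p w) (dia_right_double md p w)
    (@form_d k (tensor A B)).
Proof.
have [asd _ inv] := dc; have [bd _] := asd.
have [pp sw qw] := qp; have [[_ wr] aw _] := sw; have [bp _] := pp.
have [fK fVK] := double_iso_bij A sw.
have dia := dia_tensor asd pp.
have [[bl br] _ _ _] := dia.
have bu := op_bullet_bilinear bl br.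
(* Values in [k^o] make [F] a vector-valued map, to which the trilinearity lemmas apply. *)
pose F s t : k^o := form_d (f s) (f t).
have bF : bilinear_op F.
  have [[dl dr] _ _] := form_d_symplectic (tensor A B).
  by split=> [t|s] c x y; rewrite /F linearP ?dl ?dr.
have uE x a y b :
    op_bullet (dia_left md p) (dia_right md p) (tens x a) (tens y b) =
    tens (md x y) (p b a - p a b).
  have [_ tr] := tens_bilinear (dsum A) B.
  rewrite /op_bullet [dia_left _ _ _ _]tensor_op_tens //.
  rewrite [dia_right _ _ _ _]tensor_op_tens //; last exact: bilinear_flip.
  by rewrite (linear_sub _ _ (tr _)).
have wB a b c : w a (b - c) = w a b - w a c.
  exact: (linear_sub (g := w a : B -> k^o) _ _ (wr a)).
have inv1 s t v : F s (dia_left md p t v)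
    = F v (op_bullet (dia_left md p) (dia_right md p) s t).
  move: s t v; apply: tens_ext3.
  - exact: trilinear_compr.
  - exact: (trilinear_compl bu (bilinear_flip bF)).
  move=> x a y b z c; rewrite uE [dia_left _ _ _ _]tensor_op_tens //.
  (* Invariance and symmetry of [form_s] rotate the first factor; antisymmetry and the quadratic
     perm identity rotate the second. *)
  rewrite /F !form_d_double_iso -inv; congr (_ * _).
    by rewrite /form_s addrC.
  by rewrite aw qw !wB opprB.
have inv2 s t v : F (dia_right md p s t) v
    = F s (op_bullet (dia_left md p) (dia_right md p) t v).
  move: s t v; apply: tens_ext3.
  - exact: trilinear_compl.
  - exact: trilinear_compr.
  move=> x a y b z c; rewrite uE [dia_right _ _ _ _]tensor_op_tens //.
    by rewrite /F !form_d_double_iso inv qw.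
  exact: bilinear_flip.
split.
- exact: dia_transport.
- exact: form_d_symplectic.
- move=> X Y Z; have := inv1 (f^-1%VF X) (f^-1%VF Y) (f^-1%VF Z).
  by rewrite /F /op_bullet linearB !fVK.
move=> X Y Z; have := inv2 (f^-1%VF X) (f^-1%VF Y) (f^-1%VF Z).
by rewrite /F /op_bullet linearB !fVK.
Qed.

End Quadratic.

Theorem proposition5p28 (k : fieldType) (k_char0 : [pchar k] =i pred0)
  (A : vectType k) (mA : A -> A -> A) (Delta : A -> tensor A A)
  (mAs : dual A -> dual A -> dual A) (md : dsum A -> dsum A -> dsum A)
  (B : vectType k) (pB : B -> B -> B) (omega : B -> B -> k) :
  ASI_bialgebra mA Delta ->
  is_linear_dual Delta mAs ->
  double_construction md mA mAs ->
  quadratic_perm pB omega ->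
  standard_Manin_triple
    (dia_left_double md pB omega) (dia_right_double md pB omega)
    (dia_left mA pB) (dia_right mA pB)
    (dia_left_dual mAs pB omega) (dia_right_dual mAs pB omega) /\
  (forall Dl Dr : tensor A B -> tensor (tensor A B) (tensor A B),
    is_linear_dual Dl (dia_left_dual mAs pB omega) ->
    is_linear_dual Dr (dia_right_dual mAs pB omega) ->
    diassociative_bialgebra (dia_left mA pB) (dia_right mA pB) Dl Dr).
Proof.
move=> _ _ dc qp.
have [[bd _] ed _] := dc; have [[bp _] sw _] := qp.
have mt : standard_Manin_triple
    (dia_left_double md pB omega) (dia_right_double md pB omega)
    (dia_left mA pB) (dia_right mA pB)
    (dia_left_dual mAs pB omega) (dia_right_dual mAs pB omega).
  split; first exact: double_quadratic dc qp.
  - exact: extends_tensor.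
  (* Here [n] is the opposite of [pB], and the induced product on the dual of [B] unfolds to the
     opposite of [perm_dual]. *)
  - exact: (extends_tensor sw bd ed (bilinear_flip bp)).
by split=> // Dl Dr hl hr; exact: Manin_triple_bialgebra mt _ _ hl hr.
Qed.
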